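(* Let $\Gamma_1$ and $\Gamma_2$ be two finite simple graphs, and let $F_1,\ldots,F_n$ ($n\ge 1$) be a forest decomposition of $\Gamma_1$. For $i=1,\ldots,n$ let $F'_i:=\bigl(\Gamma_1-E(F_1)\cup\cdots\cup E(F_{i-1})\bigr)[V(F_i)]$. Then \[\mathrm{pmd}(\Gamma_1\square\Gamma_2)\leq n\cdot\mathrm{pmd}(\Gamma_2)+\sum_{i=1}^n\max\{\Delta(F'_i),\chi(\Gamma_2)\}.\]
   Context: All graphs are finite and simple. A set $M\subseteq E$ of edges of a graph $\Gamma=(V,E)$ is a matching if its edges are pairwise disjoint. A matching $M$ is positive (in $\Gamma$) if there is a weight function $w\colon V\to\mathbb{R}$ such that for every edge $uv\in E$: $w(u)+w(v)>0$ if and only if $uv\in M$. A positive matching decomposition (pmd) of $\Gamma$ with $p$ parts is an ordered partition $E_1,\ldots,E_p$ of $E$ such that $E_i$ is a positive matching of the graph $(V,E\setminus\bigcup_{j=1}^{i-1}E_j)$ for $i=1,\ldots,p$. $\mathrm{pmd}(\Gamma)$ denotes the smallest $p$ for which $\Gamma$ has a pmd with $p$ parts. The Cartesian product $\Gamma_1\square\Gamma_2$ has vertex set $V(\Gamma_1)\times V(\Gamma_2)$, with $(a_1,a_2)\sim(b_1,b_2)$ if either $a_1=b_1$ and $a_2\sim b_2$, or $a_1\sim b_1$ and $a_2=b_2$. $\chi$ is the chromatic number and $\Delta$ the maximum degree. For a set $E'$ of edges, $\Gamma-E'$ is the graph obtained from $\Gamma$ by deleting the edges in $E'$ (keeping all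 vertices), and $\Gamma[U]$ is the subgraph induced by the vertex set $U$. A forest decomposition of a graph $\Gamma$ is an ordered edge-partition of $\Gamma$ into forests $F_1,\ldots,F_n$ (subgraphs of $\Gamma$ whose edge sets partition $E(\Gamma)$) such that, for all $i=1,\ldots,n$, the subgraph of $\Gamma-E(F_1)\cup\cdots\cup E(F_{i-1})$ induced by $V(F_i)$ is a forest. *)

(* Defs.v *)
From HB Require Import structures.
From mathcomp Require Import all_boot all_order all_algebra.
From mathcomp Require Import boolp reals.

Set Implicit Arguments.
Unset Strict Implicit.
Unset Printing Implicit Defensive.

Import Order.TTheory GRing.Theory Num.Theory.

(* A finite simple graph with vertices in an ambient finite type T.  The vertex
   set is a subset of T so that a graph and its subgraphs have the same type. *)
Record sgraph (T : finType) := SGraph {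
  vset : {set T};
  eset : {set {set T}};
  esetP : [forall e in eset, (e \subset vset) && (#|e| == 2)]
}.

Section Graphs.
Variable T : finType.
Implicit Types (G H : sgraph T) (U : {set T}) (D M : {set {set T}}).

Definition adj G : rel T := [rel u v | [set u; v] \in eset G].

Lemma eset_sub G e : e \in eset G -> e \subset vset G.
Proof. by move=> eG; have /forall_inP/(_ e eG)/andP[] := esetP G. Qed.

Lemma eset_card G e : e \in eset G -> #|e| = 2.
Proof. by move=> eG; have /forall_inP/(_ e eG)/andP[_ /eqP] := esetP G. Qed.

Lemma adj_neq G u v : adj G u v -> u != v.
Proof. by move=> /eset_card; rewrite cards2; case: eqVneq. Qed.

Lemma adj_sym G : symmetric (adj G).
Proof. by move=> u v; rewrite /adj /= setUC. Qed.

Lemma adj_vset G u v : adj G u v -> (u \in vset G) && (v \in vset G).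
Proof. by move=> /eset_sub; rewrite subUset !sub1set. Qed.

Definition is_subgraph H G : Prop :=
  vset H \subset vset G /\ eset H \subset eset G.

Fact del_edges_subproof G D :
  [forall e in eset G :\: D, (e \subset vset G) && (#|e| == 2)].
Proof.
apply/forall_inP => e /setDP[eG _].
by rewrite (eset_sub eG) (eset_card eG).
Qed.

Definition del_edges G D : sgraph T := SGraph (del_edges_subproof G D).

Fact induced_subproof G U :
  [forall e in [set e in eset G | e \subset U],
    (e \subset vset G :&: U) && (#|e| == 2)].
Proof.
apply/forall_inP => e; rewrite inE => /andP[eG eU].
by rewrite subsetI (eset_sub eG) eU (eset_card eG).
Qed.

Definition induced G U : sgraph T := SGraph (induced_subproof G U).

Definition is_forest G : Prop :=
  forall c : seq T, ucycle (adj G) c -> size c <= 2.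

Definition max_degree G : nat :=
  \max_(v in vset G) #|[set e in eset G | v \in e]|.

(* Only the colours of the vertices of G are bounded by k, so that the graph
   without vertices is 0-colorable even when T is inhabited. *)
Definition colorable G (k : nat) : Prop :=
  exists c : T -> nat,
    {in vset G, forall v, c v < k} /\ forall u v, adj G u v -> c u != c v.

Fact colorable_ex G : exists k, `[< colorable G k >].
Proof.
exists #|T|; apply/asboolP; exists (fun v => nat_of_ord (enum_rank v)).
split=> [v _|u v /adj_neq]; first exact: ltn_ord.
by apply: contra => /eqP/ord_inj/enum_rank_inj->.
Qed.

Definition chromatic_number G : nat := ex_minn (colorable_ex G).

Definition matching G M : Prop := M \subset eset G /\ trivIset M.

Definition positive_matching (R : realType) G M : Prop :=
  matching G M /\
  exists w : T -> R, forall u v, adj G u v ->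
    ((0 < w u + w v)%R <-> [set u; v] \in M).

(* Empty parts are allowed. *)
Definition ordered_partition (p : nat) (E : 'I_p -> {set {set T}}) D : Prop :=
  \bigcup_(i < p) E i = D /\ forall i j, i != j -> [disjoint E i & E j].

Definition previous (p : nat) (E : 'I_p -> {set {set T}}) (i : 'I_p) :
    {set {set T}} :=
  \bigcup_(j < p | j < i) E j.

Definition is_pmd (R : realType) G (p : nat) (E : 'I_p -> {set {set T}}) :
    Prop :=
  ordered_partition E (eset G) /\
  forall i, positive_matching R (del_edges G (previous E i)) (E i).

Definition has_pmd (R : realType) G (p : nat) : Prop :=
  exists E : 'I_p -> {set {set T}}, is_pmd R G E.

Fact has_pmd_ex (R : realType) G : exists p, `[< has_pmd R G p >].
Proof.
exists #|eset G|; apply/asboolP.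
exists (fun i => [set enum_val i]); split; first split.
- apply/setP=> e; apply/bigcupP/idP => [[i _ /set1P->]|eG].
    exact: enum_valP.
  by exists (enum_rank_in eG e); rewrite ?inE ?enum_rankK_in.
- move=> i j; apply: contraR => /pred0Pn[e /andP[/set1P-> /set1P]].
  by move/enum_val_inj->.
move=> i; split; first split.
- rewrite sub1set inE enum_valP andbT; apply/bigcupP => -[j ltji /set1P].
  by move/enum_val_inj => eij; rewrite eij ltnn in ltji.
- by apply/trivIsetP => A B /set1P-> /set1P->; rewrite eqxx.
set e := enum_val i.
have e2 : #|e| = 2 by apply/(@eset_card G)/enum_valP.
exists (fun v => if v \in e then 1 else - 1)%R => u v uv.
have neq_uv := adj_neq uv; rewrite inE.
have -> : ([set u; v] == e) = (u \in e) && (v \in e).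
  by rewrite eqEcard e2 cards2 neq_uv andbT subUset !sub1set.
case: (u \in e); case: (v \in e) => /=; split=> //.
- by move=> _; rewrite addr_gt0 ?ltr01.
- by rewrite subrr ltxx.
- by rewrite addNr ltxx.
- by rewrite -opprD oppr_gt0 ltNge addr_ge0 ?ler01.
Qed.

Definition pmd (R : realType) G : nat := ex_minn (has_pmd_ex R G).

Definition residual_graph G (n : nat) (F : 'I_n -> sgraph T) (i : 'I_n) :
    sgraph T :=
  induced (del_edges G (previous (fun j => eset (F j)) i)) (vset (F i)).

Definition forest_decomposition G (n : nat) (F : 'I_n -> sgraph T) : Prop :=
  [/\ forall i, is_subgraph (F i) G,
      forall i, is_forest (F i),
      ordered_partition (fun i => eset (F i)) (eset G)
    & forall i, is_forest (residual_graph G F i)].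

End Graphs.

Section CartesianProduct.
Variables (T1 T2 : finType) (G1 : sgraph T1) (G2 : sgraph T2).

Definition cart_rel : rel (T1 * T2) :=
  [rel a b | (a.1 == b.1) && adj G2 a.2 b.2 || adj G1 a.1 b.1 && (a.2 == b.2)].

Definition cart_vset : {set T1 * T2} := setX (vset G1) (vset G2).

Definition cart_eset : {set {set T1 * T2}} :=
  [set [set a; b] | a in cart_vset, b in cart_vset & cart_rel a b].

Lemma cart_rel_neq a b : cart_rel a b -> a != b.
Proof.
apply: contraL => /eqP->; rewrite /cart_rel [in ~~ _]/= !eqxx andbT andTb negb_or.
by apply/andP; split; apply/negP => /(@adj_neq _ _ _ _)/eqP.
Qed.

Lemma cart_rel_sym : symmetric cart_rel.
Proof.
move=> a b; rewrite /cart_rel /= (eq_sym a.1) (eq_sym a.2).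
by rewrite (adj_sym G1) (adj_sym G2).
Qed.

Fact cart_subproof :
  [forall e in cart_eset, (e \subset cart_vset) && (#|e| == 2)].
Proof.
apply/forall_inP => e /imset2P[a b aV]; rewrite inE => /andP[bV ab ->].
by rewrite subUset !sub1set aV bV cards2 (cart_rel_neq ab).
Qed.

Definition cart_prod : sgraph (T1 * T2)%type := SGraph cart_subproof.

Lemma adj_cart_prod a b :
  adj cart_prod a b =
  [&& a \in cart_vset, b \in cart_vset & cart_rel a b].
Proof.
apply/imset2P/and3P => [[x y xV]|[aV bV ab]]; last first.
  by exists a b; rewrite // inE bV.
rewrite inE => /andP[yV xy] eab.
have := cart_rel_neq xy; have xab : x \in [set a; b] by rewrite eab set21.
have yab : y \in [set a; b] by rewrite eab set22.
move: xab yab xV yV xy; rewrite !in_set2.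
case/orP=> /eqP-> /orP[]/eqP-> => aV bV ab; rewrite ?eqxx //.
by rewrite cart_rel_sym in ab.
Qed.

End CartesianProduct.

(* Main.v *)
(* One positive matching decomposition of G2, applied to all copies of G2 at
   once, is enough: it works as soon as all G1-edges are gone.  These are removed
   in n stages, the i-th one removing what is left inside V(F_i) x V(G2), where
   the vertices outside receive a very negative weight.  With
   k = max (Delta F'_i) (chi G2), colour the edges of the forest F'_i properly and
   the vertices of G2 properly by residues mod k; the copies of an edge ab of F'_i
   in the layer x with colour(ab) + colour(x) = t mod k form the t-th matching, so
   that adjacent layers use different colour classes of the forest. *)

Require Import Defs.
From mathcomp Require Import all_boot all_order all_algebra.
From mathcomp Require Import boolp reals.
From mathcomp Require Import zify lra.

Set Implicit Arguments.
Unset Strict Implicit.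
Unset Printing Implicit Defensive.

Import Order.TTheory GRing.Theory Num.Theory.

Lemma set2_inj (T : finType) (a b c : T) : [set a; b] = [set a; c] -> b = c.
Proof.
move=> E.
have: b \in [set a; c] by rewrite -E set22.
have: c \in [set a; b] by rewrite E set22.
by rewrite !in_set2 => /orP[/eqP->|/eqP->//] /orP[]/eqP->.
Qed.

(** * Positive matching decompositions as chains of relations *)

Section Peeling.
Variables (R : realType) (T : finType).
Implicit Types (r : rel T) (G : sgraph T).

(* Removing one positive matching: the edges with positive weight. *)
Definition peel r r' : Prop :=
  exists w : T -> R,
    (forall a b, r' a b = r a b && (w a + w b <= 0)%R) /\
    (forall a b c, r a b -> r a c ->
       (0 < w a + w b)%R -> (0 < w a + w c)%R -> b = c).

(** The chain is indexed by [nat] rather than by ordinals, so that chains can be concatenated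
    without casts. *)
Definition peels p r r' : Prop :=
  exists C : nat -> rel T,
    [/\ C 0 =2 r, C p =2 r' & forall t, t < p -> peel (C t) (C t.+1)].

Lemma eq_peel r1 r2 r1' r2' :
  r1 =2 r2 -> r1' =2 r2' -> peel r1 r1' -> peel r2 r2'.
Proof.
move=> E E' [w [rE mw]]; exists w; split=> [a b|a b c]; first by rewrite -E -E'.
by rewrite -!E; apply: mw.
Qed.

Lemma eq_peels p r1 r2 r1' r2' :
  r1 =2 r2 -> r1' =2 r2' -> peels p r1 r1' -> peels p r2 r2'.
Proof.
move=> E E' [C [C0 Cp Cs]]; exists C; split=> // a b; first by rewrite C0.
by rewrite Cp.
Qed.

Lemma peels0 r : peels 0 r r.
Proof. by exists (fun=> r). Qed.

Lemma peels_trans p q r1 r2 r3 :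
  peels p r1 r2 -> peels q r2 r3 -> peels (p + q) r1 r3.
Proof.
move=> [C [C0 Cp Cs]] [D [D0 Dq Ds]].
exists (fun t => if t < p then C t else D (t - p)); split.
(* For [p = 0] the combined chain starts directly with [D], and [r1] and [r2] agree because both
   agree with [C 0]. *)
- case: p Cp {Cs} => [|p] Cp a b; last exact: C0.
  by rewrite /= D0 -Cp C0.
- by move=> a b; rewrite ltnNge leq_addr /= addKn Dq.
move=> t tpq /=; have [tp|pt] := ltnP t p.
  have [_|pt] := ltnP t.+1 p; first exact: Cs.
  (* At the junction [t.+1 = p] the two chains meet: [C p] and [D 0] both agree with [r2]. *)
  have -> : t.+1 - p = 0 by lia.
  apply: eq_peel (Cs _ tp) => // a b.
  have -> : t.+1 = p by lia.
  by rewrite Cp D0.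
rewrite ltnNge (leq_trans pt) //= subSn //; apply: Ds; lia.
Qed.

Lemma peels_sum n (k : 'I_n -> nat) (r : nat -> rel T) :
  (forall i : 'I_n, peels (k i) (r i) (r i.+1)) ->
  peels (\sum_(i < n) k i) (r 0) (r n).
Proof.
elim: n k r => [|n IH] k r H; first by rewrite big_ord0; apply: peels0.
rewrite big_ord_recr; apply: peels_trans (H ord_max).
by apply: (IH (fun i => k (widen_ord (leqnSn n) i))) => i; apply: H.
Qed.

Lemma chain_sub p (C : nat -> rel T) s t a b :
  (forall t, t < p -> peel (C t) (C t.+1)) -> s <= t <= p -> C t a b -> C s a b.
Proof.
move=> Cs /andP[]; elim: t => [|t IH]; first by rewrite leqn0 => /eqP->.
rewrite leq_eqVlt => /orP[/eqP->//|st tp].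
by have [w [-> _]] := Cs _ tp; case/andP=> /IH-> //; apply: ltnW.
Qed.

Lemma chain_sym p (C : nat -> rel T) t :
  (forall t, t < p -> peel (C t) (C t.+1)) -> symmetric (C 0) ->
  t <= p -> symmetric (C t).
Proof.
move=> Cs C0; elim: t => [//|t IH] tp a b.
by have [w [E _]] := Cs _ tp; rewrite !E addrC (IH (ltnW tp) a).
Qed.

Lemma chain_drop p (C : nat -> rel T) t a b :
  (forall t, t < p -> peel (C t) (C t.+1)) -> t <= p -> C 0 a b ->
  ~~ C t a b -> exists2 j, j < t & C j a b && ~~ C j.+1 a b.
Proof.
move=> Cs + C0; elim: t => [|t IH] tp; first by rewrite C0.
have [Ct nC|nC _] := boolP (C t a b); first by exists t; rewrite ?Ct.
by have [j jt Cj] := IH (ltnW tp) nC; exists j; rewrite // ltnW.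
Qed.

Lemma eset_pair G e : e \in eset G -> exists a b, e = [set a; b] /\ adj G a b.
Proof.
move=> eG; have /eqP/cards2P[a [b [_ E]]] := eset_card eG.
by exists a, b; split; rewrite // /adj /= -E.
Qed.

(** Part [E i] collects the edges that disappear between [C i] and [C i.+1]. Since the chain
    decreases from [adj G] to the empty relation, each edge disappears exactly once. *)
Lemma peels_has_pmd G p : peels p (adj G) (fun _ _ => false) -> has_pmd R G p.
Proof.
move=> [C [C0 Cp Cs]].
have sym0 : symmetric (C 0) by move=> a b; rewrite !C0 adj_sym.
pose E (i : 'I_p) := [set e in eset G |
  [exists a, [exists b, [&& e == [set a; b], C i a b & ~~ C i.+1 a b]]]].
have CG t a b : t <= p -> C t a b -> adj G a b.
  by move=> tp; rewrite -C0; apply: (chain_sub Cs); rewrite tp.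
have E_in (i : 'I_p) a b : ([set a; b] \in E i) = C i a b && ~~ C i.+1 a b.
  rewrite inE; apply/andP/idP => [[_ /existsP[c /existsP[d]]]|Ci].
    (* The witnesses may describe the edge in the opposite orientation; the symmetry of each [C t]
       then gives the claim. *)
    case/and3P => /eqP cd Ci Ci1.
    have: a \in [set c; d] by rewrite -cd set21.
    rewrite in_set2 => /orP[]/eqP ac.
      by move: cd; rewrite ac => /set2_inj->; rewrite Ci.
    have bc : b = c by move: cd; rewrite ac (setUC [set c]) => /set2_inj.
    rewrite ac bc (chain_sym Cs sym0 (ltnW (ltn_ord i))) Ci.
    by rewrite (chain_sym Cs sym0 (ltn_ord i)).
  split; last by apply/existsP; exists a; apply/existsP; exists b; rewrite eqxx.
  by case/andP: Ci => /CG-/(_ (ltnW (ltn_ord i))).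
have prevE (i : 'I_p) a b : adj G a b ->
    ([set a; b] \notin previous E i) = C i a b.
  move=> ab; apply/idP/idP => [|Ci].
    apply: contraR => /(chain_drop Cs (ltnW (ltn_ord i))); rewrite C0.
    case=> // j ji Cj; apply/bigcupP.
    by exists (Ordinal (ltn_trans ji (ltn_ord i))); rewrite ?E_in.
  apply/bigcupP => -[j ji]; rewrite E_in => /andP[_] /negP; apply.
  by apply: (chain_sub Cs) Ci; rewrite ji ltnW.
exists E; split; first split.
- apply/setP => e; apply/bigcupP/idP => [[i _]|eG]; first by rewrite inE => /andP[].
  have [a [b [eE ab]]] := eset_pair eG.
  have := @chain_drop p C p a b Cs (leqnn p); rewrite C0 Cp => -[]// j jp Cj.
  by exists (Ordinal jp); rewrite // eE E_in.
- move=> i j ij; apply/pred0P => e /=; apply/negP => /andP[].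
  wlog lt_ij : i j ij / i < j.
    move=> W ei ej; case: (ltngtP i j) => [lt|lt|/val_inj eq].
    - exact: (W i j).
    - by apply: (W j i); rewrite // eq_sym.
    - by rewrite eq eqxx in ij.
  move=> ei; have [a [b [eE ab]]] : exists a b, e = [set a; b] /\ adj G a b.
    by apply: eset_pair; move: ei; rewrite inE => /andP[].
  move: ei; rewrite eE !E_in => /andP[_ /negP nC] /andP[Cj _]; apply: nC.
  by apply: (chain_sub Cs) Cj; rewrite lt_ij ltnW.
move=> i; have [w [CE mw]] := Cs _ (ltn_ord i).
split; first split.
- apply/subsetP => e eE; have eG : e \in eset G by move: eE; rewrite inE => /andP[].
  have [a [b [eab ab]]] := eset_pair eG; rewrite inE eG andbT eab prevE //.
  by move: eE; rewrite eab E_in => /andP[].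
(* Members of [E i] are written with a chosen endpoint first. Two members sharing [z] are then two
   edges of positive weight at [z], which a peel forces to coincide. *)
- have pairE e z : e \in E i -> z \in e ->
      exists2 b, e = [set z; b] & C i z b /\ (0 < w z + w b)%R.
    move=> eE; have [a [b [eab ab]]] : exists a b, e = [set a; b] /\ adj G a b.
      by apply: eset_pair; move: eE; rewrite inE => /andP[].
    move=> ze; suff [c ec]: exists c, e = [set z; c].
      exists c => //; move: eE; rewrite ec E_in CE => /andP[Ci].
      by rewrite Ci /= -ltNge.
    move: ze; rewrite eab in_set2 => /orP[]/eqP->; first by exists b.
    by exists a; rewrite setUC.
  apply/trivIsetP => A B AE BE; apply: contraR => /pred0Pn[z /andP[zA zB]].
  have [b eb [zb wb]] := pairE _ _ AE zA; have [c ec [zc wc]] := pairE _ _ BE zB.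
  by rewrite eb ec (mw z b c).
exists w => u v; rewrite /adj /= inE => /andP[nprev uv].
rewrite E_in CE -(prevE _ _ _ uv) nprev /= -ltNge; by [].
Qed.

(** After [t] steps there remain the edges outside the first [t] parts, and the weight of part [t]
    serves for the next peel. *)
Lemma has_pmd_peels G p : has_pmd R G p -> peels p (adj G) (fun _ _ => false).
Proof.
move=> [E [[EG _] Epos]].
exists (fun t a b => adj G a b && ([set a; b] \notin \bigcup_(j < p | j < t) E j)).
split=> [a b|a b|t tp].
- by rewrite big_pred0 ?inE ?andbT.
- rewrite /adj /= -EG; apply/andP => -[/bigcupP[j _ jE] /negP]; apply.
  by apply/bigcupP; exists j.
have [[Msub /trivIsetP Mtriv] [w wE]] := Epos (Ordinal tp).
have adjD a b : adj (del_edges G (previous E (Ordinal tp))) a b =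
    adj G a b && ([set a; b] \notin \bigcup_(j < p | j < t) E j).
  by rewrite /adj /= inE andbC.
exists w; split=> [a b|a b c]; last first.
  rewrite -!adjD => ab ac /wE-/(_ ab) abE /wE-/(_ ac) acE.
  apply/(@set2_inj _ a)/eqP.
  apply: contraT => /(Mtriv _ _ abE acE)/pred0P/(_ a).
  by rewrite /= !in_set2 eqxx.
have -> : \bigcup_(j < p | j < t.+1) E j =
    (\bigcup_(j < p | j < t) E j) :|: E (Ordinal tp).
  rewrite (bigD1 (Ordinal tp)) //= setUC; congr (_ :|: _); apply: eq_bigl => j.
  by rewrite ltnS [in RHS]ltn_neqAle andbC.
rewrite in_setU negb_or andbA -adjD.
case: (boolP (adj (del_edges _ _) a b)) => //= /wE ab.
rewrite leNgt; congr negb; apply/idP/idP; by rewrite ab.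
Qed.

End Peeling.

(** * Vertex orders and proper edge colourings of forests *)

Section ForestOrder.
Variables (T : finType) (e : rel T) (k : nat).
Hypothesis e_sym : symmetric e.
Hypothesis e_irr : irreflexive e.
Hypothesis e_acyclic : forall c, ucycle e c -> size c <= 2.
Hypothesis e_deg : forall v, #|[set b | e v b]| <= k.

(** Otherwise every vertex of [U] has a neighbour in [U] different from any prescribed vertex, so
    simple paths can be extended indefinitely in a finite type. *)
Lemma forest_leaf (U : {set T}) x0 : x0 \in U ->
  exists v z, v \in U /\ forall y, y \in U -> e v y -> y = z.
Proof.
move=> x0U; apply: contrapT => noleaf.
have next v z : v \in U -> exists y, [/\ y \in U, e v y & y != z].
  move=> vU; apply: contrapT => N; apply: noleaf; exists v, z; split=> // y yU vy.
  by apply/eqP; apply: contraT => yz; case: N; exists y.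
have long m : exists x p, [/\ size p = m, path e x p, uniq (x :: p) & x \in U].
  elim: m => [|m [x [p [sp xp up xU]]]]; first by exists x0, [::].
  (* The new vertex avoids the second vertex of the path, so a return to the path would close a
     cycle of length at least 3. For empty [p] the default of [head] is [x] itself. *)
  have [y [yU xy yz]] := next x (head x p) xU.
  exists y, (x :: p); split=> //; first by rewrite /= sp.
    by rewrite /= e_sym xy.
  rewrite cons_uniq up andbT inE negb_or; apply/andP; split.
    by apply: contraTneq xy => ->; rewrite e_irr.
  apply/negP => yp; case/splitPr: yp sp xp up yz => [[|z p1] p2] _.
    by rewrite /= eqxx.
  rewrite -cat_rcons cat_path -cat_cons cat_uniq => /andP[xp _] /andP[up _] _.
  suff /e_acyclic : ucycle e (x :: rcons (z :: p1) y) by rewrite /= size_rcons.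
  by rewrite /ucycle up andbT /cycle rcons_path xp last_rcons e_sym.
have [x [p [sp _ /card_uniqP up _]]] := long #|T|.
by have := max_card (mem (x :: p)); rewrite up /= sp ltnn.
Qed.

(* d orders the vertices away from the root, and the colour of an edge is stored
   at its later end, the child.  Properness of this colouring also forces every
   vertex to have at most one earlier neighbour. *)
Definition edge_colour (d s : T -> nat) a b := if d a < d b then s b else s a.

(** Induction on the size of [U]: a vertex [v] with at most one neighbour [z] in [U] is taken out,
    then placed last in the order, with a colour that is free at [z]. *)
Lemma forest_order_in (U : {set T}) : exists d s : T -> nat,
  (forall a b, a \in U -> b \in U -> e a b ->
     d a <> d b /\ edge_colour d s a b < k) /\
  (forall a b c, a \in U -> b \in U -> c \in U -> e a b -> e a c ->
     edge_colour d s a b = edge_colour d s a c -> b = c).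
Proof.
have [m] := ubnP #|U|; elim: m U => // m IH U; rewrite ltnS => cardU.
have [->|[x0 x0U]] := set_0Vmem U.
  by exists (fun=> 0), (fun=> 0); split=> [a b|a b c]; rewrite inE.
have [v [z [vU leaf]]] := forest_leaf x0U.
have [|d [s [H1 H2]]] := IH (U :\ v).
  by apply: leq_trans cardU; rewrite [X in _ < X](cardsD1 v) vU.
(* Besides [v], the vertex [z] has at most [k - 1] neighbours, so one of the [k] colours is free. If
   [z] and [v] are not adjacent, [v] has no neighbour in [U] and any [j] will do. *)
have [j jP] : exists j, e z v ->
    j < k /\ forall b, b != v -> e z b -> edge_colour d s z b <> j.
  have [zv|] := boolP (e z v); last by exists 0.
  pose used := [seq edge_colour d s z b | b in [set b | e z b] :\ v].
  have [/allP sub|/allPn[j]] := boolP (all (mem used) (iota 0 k)).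
    have := uniq_leq_size (iota_uniq 0 k) sub.
    rewrite size_iota size_image leqNgt; case/negP.
    by apply: leq_trans (e_deg z); rewrite [X in _ < X](cardsD1 v) inE zv.
  rewrite mem_iota => jk jused; exists j => _; split=> // b bv zb bj.
  by case/negP: jused; rewrite -bj; apply: image_f; rewrite !inE bv.
(* Exceeding all earlier values makes [v] the child on its edge; the colour is stored at [v] and the
   old edges keep theirs. *)
pose d' x := if x == v then (\max_y d y).+1 else d x.
pose s' x := if x == v then j else s x.
have old a b : a != v -> b != v -> edge_colour d' s' a b = edge_colour d s a b.
  by rewrite /edge_colour /d' /s' => /negPf-> /negPf->.
have lt_d a : a != v -> d' a < d' v.
  by rewrite /d' eqxx => /negPf->; rewrite ltnS leq_bigmax.
have newr a : a != v -> edge_colour d' s' a v = j.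
  by move=> av; rewrite /edge_colour lt_d // /s' eqxx.
have newl a : a != v -> edge_colour d' s' v a = j.
  by move=> av; rewrite /edge_colour ltnNge ltnW ?lt_d // /s' eqxx.
have neq a b : e a b -> a != b by apply: contraTneq => ->; rewrite e_irr.
exists d', s'; split=> [a b aU bU ab|a b c aU bU cU ab ac].
  have [av|av] := eqVneq a v.
    have bv : b != v by rewrite -av eq_sym neq.
    have bz : b = z by apply: leaf; rewrite -?av.
    rewrite av newl //; split; first by have := lt_d _ bv; lia.
    by case: jP; rewrite // -bz e_sym -av.
  have [bv|bv] := eqVneq b v.
    have az : a = z by apply: leaf; rewrite // e_sym -bv.
    rewrite bv newr //; split; first by have := lt_d _ av; lia.
    by case: jP; rewrite // -az -bv.
  rewrite old // /d' (negPf av) (negPf bv); apply: H1 => //; exact/setD1P.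
have [av|av] := eqVneq a v.
  by rewrite (leaf b) -?(leaf c) -?av.
have az x : x = v -> e a x -> a = z by move=> -> ax; apply: leaf; rewrite // e_sym.
have [bv|bv] := eqVneq b v; have [cv|cv] := eqVneq c v.
- by rewrite bv cv.
- rewrite bv newr // old // => jE; have zE := az _ bv ab.
  by case: jP => [|_ /(_ c cv)]; rewrite -zE -?bv // => /(_ ac) [].
- rewrite cv newr // old // => jE; have zE := az _ cv ac.
  by case: jP => [|_ /(_ b bv)]; rewrite -zE -?cv // => /(_ ab) [].
- by rewrite !old //; apply: H2 => //; apply/setD1P.
Qed.

End ForestOrder.

Lemma forest_order (T : finType) (H : sgraph T) k :
  is_forest H -> max_degree H <= k -> exists d s : T -> nat,
  (forall a b, adj H a b -> d a <> d b /\ edge_colour d s a b < k) /\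
  (forall a b c, adj H a b -> adj H a c ->
     edge_colour d s a b = edge_colour d s a c -> b = c).
Proof.
move=> Hf Hk; have irr : irreflexive (adj H).
  by move=> a; apply/negP => /(@adj_neq _ _ _ _); rewrite eqxx.
have deg v : #|[set b | adj H v b]| <= k.
  have [vH|vH] := boolP (v \in vset H); last first.
    rewrite (_ : [set b | _] = set0) ?cards0 //; apply/setP => b.
    by rewrite !inE; apply: contraNF vH => /(@adj_vset _ _ _ _)/andP[].
  apply: leq_trans (leq_trans (leq_bigmax_cond _ vH) Hk).
  rewrite -(card_imset _ (@set2_inj _ v)); apply/subset_leq_card/subsetP => f.
  by case/imsetP => b; rewrite !inE => vb ->; rewrite [_ \in eset H]vb set21.
have [d [s [H1 H2]]] := forest_order_in (@adj_sym _ H) irr Hf deg setT.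
by exists d, s; split=> [a b|a b c]; [apply: H1 | apply: H2].
Qed.

Lemma chromatic_colouring (T : finType) (G : sgraph T) :
  colorable G (chromatic_number G).
Proof. by rewrite /chromatic_number; case: ex_minnP => m /asboolP. Qed.

(** This serves twice: to recover an edge colour from its level in a fixed layer, and to separate
    the residues of two adjacent layers. *)
Lemma modnD_inj k a b c : a < k -> b < k ->
  (a + c) %% k = (b + c) %% k -> a = b.
Proof. by move=> ak bk /eqP; rewrite eqn_modDr !modn_small // => /eqP. Qed.

(** * Stages of the decomposition of the Cartesian product *)

Section Product.
Variables (R : realType) (T1 T2 : finType) (G1 : sgraph T1) (G2 : sgraph T2).
Variables (n : nat) (F : 'I_n -> sgraph T1).

Definition fibre_rel (r : rel T2) : rel (T1 * T2) :=
  [rel a b | [&& a.1 \in vset G1, a.1 == b.1 & r a.2 b.2]].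

(* Stage i removes all remaining G1-edges inside V(F_i), including those that
   belong to some later F_j. *)
Definition stage_rel (i : nat) : rel (T1 * T2) :=
  [rel a b | adj (cart_prod G1 G2) a b && ((a.1 == b.1) ||
    [forall j : 'I_n, (j < i) ==> ~~ ([set a.1; b.1] \subset vset (F j))])].

Lemma stage_relP i a b : stage_rel i a b ->
  (a.1 = b.1 /\ adj G2 a.2 b.2) \/
  [/\ a.1 != b.1, a.2 = b.2, adj G1 a.1 b.1 &
    forall j : 'I_n, j < i -> ~~ ([set a.1; b.1] \subset vset (F j))].
Proof.
rewrite /stage_rel /= adj_cart_prod => /andP[/and3P[_ _ ab]].
case/orP: ab => /andP[].
  by move=> /eqP ab1 ab2 _; left.
move=> ab1 /eqP ab2; rewrite (negPf (adj_neq ab1)) => /forallP abF.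
by right; split; rewrite ?(adj_neq ab1) // => j; apply/implyP.
Qed.

Lemma stage_relS (i : 'I_n) a b : stage_rel i.+1 a b =
  stage_rel i a b &&
    ((a.1 == b.1) || ~~ ([set a.1; b.1] \subset vset (F i))).
Proof.
rewrite /stage_rel /= -!andbA; case: (adj _ _ _) => //=; case: eqP => //= _.
apply/forallP/andP => [H|[/forallP H Hi] j].
  split; last by have := H i; rewrite leqnn.
  by apply/forallP => j; apply/implyP => ji; have := H j; rewrite ltnW.
rewrite ltnS leq_eqVlt; apply/implyP => /orP[/eqP/val_inj->//|ji].
by have := H j; rewrite ji.
Qed.

(** The weight depends on the second coordinate alone. Fibre edges at a vertex stay in its own copy
    of [G2], so the matching condition carries over. *)
Lemma fibre_peel r r' : peel R r r' -> peel R (fibre_rel r) (fibre_rel r').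
Proof.
move=> [w [rE mw]]; exists (fun a => w a.2); split=> [a b|a b c].
  by rewrite /fibre_rel /= rE !andbA.
move=> /and3P[_ /eqP ab1 ab] /and3P[_ /eqP ac1 ac] wb wc.
rewrite (surjective_pairing b) (surjective_pairing c) -ab1 -ac1.
by congr pair; apply: mw wb wc.
Qed.

Lemma fibre_peels p r r' :
  peels R p r r' -> peels R p (fibre_rel r) (fibre_rel r').
Proof.
move=> [C [C0 Cp Cs]]; exists (fun t => fibre_rel (C t)); split=> [a b|a b|t tp].
- by rewrite /fibre_rel /= C0.
- by rewrite /fibre_rel /= Cp.
- exact/fibre_peel/Cs.
Qed.

Lemma stage_rel0 : stage_rel 0 =2 adj (cart_prod G1 G2).
Proof.
move=> a b; rewrite /stage_rel /=; case: (adj _ _ _) => //=.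
by apply/orP; right; apply/forallP.
Qed.

(** Each edge of [G1] belongs to some [F j], hence lies inside [vset (F j)] and is gone after the
    last stage; only the copies of [G2] survive. *)
Lemma stage_reln : forest_decomposition G1 F ->
  stage_rel n =2 fibre_rel (adj G2).
Proof.
move=> [_ _ [EF _] _] a b; apply/idP/idP => [ab|/and3P[a1 /eqP ab1 ab2]].
  have [[ab1 ab2]|[_ _]] := stage_relP ab.
    case/andP: ab; rewrite adj_cart_prod inE => /and3P[/andP[a1 _] _ _] _.
    by rewrite /fibre_rel /= a1 ab1 eqxx.
  rewrite /adj /= -EF => /bigcupP[j _ jab] /(_ j (ltn_ord j)).
  by rewrite (eset_sub jab).
rewrite /stage_rel /= adj_cart_prod !inE /= /cart_rel /= -ab1 eqxx a1 ab2 /=.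
by rewrite andbT; have /andP[-> ->] := adj_vset ab2.
Qed.

Lemma stage_peels (i : 'I_n) k : is_forest (residual_graph G1 F i) ->
  max_degree (residual_graph G1 F i) <= k -> chromatic_number G2 <= k ->
  peels R k (stage_rel i) (stage_rel i.+1).
Proof.
set H := residual_graph G1 F i => Hf Hdeg Hchi.
(* A vertex a of F'_i with layer x carries weight d a if the edge from a to its
   parent is matched in that layer, and - d a otherwise.  As d increases away
   from the root, the child decides the sign on each edge of the forest, while
   adjacent layers have different colours and so cannot both be positive. *)
have [d [s [d_neq proper]]] := forest_order Hf Hdeg.
have [c [c_lt c_neq]] := chromatic_colouring G2.
have {}c_lt v : v \in vset G2 -> c v < k by move=> /c_lt/leq_trans; apply.
pose U := vset (F i).
pose lev (a b : T1 * T2) := (edge_colour d s a.1 b.1 + c a.2) %% k.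
have inH a b : stage_rel i a b -> ~~ stage_rel i.+1 a b ->
    [/\ adj H a.1 b.1, a.2 = b.2, a.1 \in U & b.1 \in U].
  move=> ab; rewrite stage_relS ab negb_or negbK => /andP[neq abU].
  move: (abU); rewrite subUset !sub1set => /andP[aU bU].
  case: (stage_relP ab) => [[E]|[_ ab2 ab1 abF]]; first by rewrite E eqxx in neq.
  split=> //; rewrite /adj /= !inE abU andbT [_ \in eset G1]ab1 andbT.
  by apply/bigcupP => -[j ji /(@eset_sub _ _ _)]; apply/negP/abF.
(* The edges to be removed in this stage go in the order of their level, level [t] in step [t]; all
   levels are below [k]. *)
exists (fun t a b => stage_rel i a b && (stage_rel i.+1 a b || (t <= lev a b))).
split=> [a b|a b|t tk].
- by rewrite /= orbT andbT.
- have [ab|] := boolP (stage_rel i a b); last by rewrite stage_relS => /negPf->.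
  have [//|nab] := boolP (stage_rel i.+1 a b).
  (* The colour of an existing edge is below [k], which gives the positivity of [k] needed for the
     remainder. *)
  have [/d_neq[_ ek] _ _ _] := inH _ _ ab nab.
  by rewrite leqNgt ltn_pmod // (leq_trans _ ek).
(* No weight exceeds [big], so an edge with an end outside [U] has total weight at most 0. *)
pose big : nat := \max_x d x.
pose w (a : T1 * T2) : R := if a.1 \in U then
  if (s a.1 + c a.2) %% k == t then (d a.1)%:R%R else (- (d a.1)%:R)%R
  else (- big%:R)%R.
have w_le a : (w a <= big%:R)%R.
  have db : ((d a.1)%:R <= big%:R :> R)%R by rewrite ler_nat leq_bigmax.
  have d0 : (0 <= (d a.1)%:R :> R)%R by apply: ler0n.
  have b0 : (0 <= big%:R :> R)%R by apply: ler0n.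
  by rewrite /w; case: ifP => _; [case: ifP => _|]; lra.
have wpos a b : adj H a.1 b.1 -> a.2 = b.2 -> a.1 \in U -> b.1 \in U ->
    (0 < w a + w b)%R = (lev a b == t).
  move=> ab1 ab2 aU bU; have [dN _] := d_neq _ _ ab1.
  rewrite /w /lev aU bU -ab2 /edge_colour.
  have dlt x y : x < y -> (0 <= x%:R :> R)%R /\ (x%:R < y%:R :> R)%R.
    by rewrite ltr_nat ler0n.
  case: ltngtP dN => // /dlt[d0 dab] _.
    case: (_ == t); case: (_ == t); apply/idP/idP => //; lra.
  case: (_ == t); case: (_ == t); apply/idP/idP => //; lra.
have wneg a b : stage_rel i.+1 a b -> (w a + w b <= 0)%R.
  rewrite stage_relS => /andP[ab].
  case: (stage_relP ab) => [[ab1 ab2] _|[ab1 _ _ _]].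
    have /andP[a2 b2] := adj_vset ab2; have d0 := ler0n R (d a.1).
    have big0 := ler0n R big.
    rewrite /w -ab1; case: ifP => _; last by lra.
    case: eqP => [sa|_]; case: eqP => [sb|_]; try lra.
    (* Both ends could carry a positive weight only if their layers had equal residues, hence equal
       colours, although the layers are adjacent. *)
    have /eqP := c_neq _ _ ab2; case.
    by apply: (@modnD_inj k _ _ (s a.1) (c_lt _ a2) (c_lt _ b2)); rewrite addnC sa addnC sb.
  rewrite (negPf ab1) /= subUset !sub1set negb_and => /orP[] /negbTE U'.
    by have := w_le b; rewrite [w a]/w U' => H1; lra.
  by have := w_le a; rewrite [w b]/w U' => H1; lra.
exists w; split=> [a b|a b b'].
  have [ab|//] := boolP (stage_rel i a b).
  have [ab'|nab] := boolP (stage_rel i.+1 a b); first by rewrite /= wneg.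
  have [ab1 ab2 aU bU] := inH _ _ ab nab.
  by rewrite /= leNgt wpos // ltn_neqAle eq_sym andbC.
have step b0 : stage_rel i a b0 -> (0 < w a + w b0)%R ->
    [/\ adj H a.1 b0.1, a.2 = b0.2 & lev a b0 = t].
  move=> ab0 wb0; have [|ab1 ab2 aU bU] := inH _ _ ab0.
    by apply: contraL wb0 => /wneg; rewrite -leNgt.
  by move: wb0; rewrite wpos // => /eqP.
move=> /andP[ab _] /andP[ab' _] /(step _ ab)[H1 E1 L1] /(step _ ab')[H2 E2 L2].
rewrite (surjective_pairing b) (surjective_pairing b') -E1 -E2; congr pair.
(* Both edges have level [t] and lie in the layer [a.2], so their colours agree modulo [k] and
   therefore agree. *)
apply: (proper _ _ _ H1 H2).
have [_ k1] := d_neq _ _ H1; have [_ k2] := d_neq _ _ H2.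
apply: (@modnD_inj k _ _ (c a.2) k1 k2).
exact: etrans L1 (esym L2).
Qed.

End Product.

(** * Assembly of the bound *)

Theorem theorem2p3 (R : realType) (T1 T2 : finType)
    (G1 : sgraph T1) (G2 : sgraph T2)
    (n : nat) (n_ge1 : 1 <= n) (F : 'I_n -> sgraph T1)
    (F_decomp : forest_decomposition G1 F) :
  pmd R (cart_prod G1 G2) <=
    n * pmd R G2 +
    \sum_(i < n) maxn (max_degree (residual_graph G1 F i)) (chromatic_number G2).
Proof.
have F_forest i : is_forest (residual_graph G1 F i) by case: F_decomp.
pose k i := maxn (max_degree (residual_graph G1 F i)) (chromatic_number G2).
rewrite -/(\sum_(i < n) k i).
have pmd2 : has_pmd R G2 (pmd R G2).
  by rewrite /pmd; case: ex_minnP => m /asboolP.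
(* The construction uses [pmd R G2] only once; [n_ge1] allows the passage to the multiple by [n]. *)
apply: (@leq_trans (pmd R G2 + \sum_(i < n) k i)); last first.
  by rewrite leq_add2r leq_pmull.
rewrite addnC {1}/pmd; case: ex_minnP => m _; apply; apply/asboolP.
apply/peels_has_pmd.
have stages : peels R (\sum_(i < n) k i)
    (stage_rel G1 G2 F 0) (stage_rel G1 G2 F n).
  by apply: peels_sum => i; apply: stage_peels; rewrite ?leq_maxl ?leq_maxr.
(* The stages lead from the whole product to the copies of [G2], which are then peeled
   simultaneously. *)
apply: peels_trans (eq_peels (stage_rel0 _ _ _) (stage_reln _ F_decomp) stages) _.
apply: eq_peels (fibre_peels G1 (has_pmd_peels pmd2)) => // a b.
by rewrite /fibre_rel /= !andbF.
Qed.
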